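(* Let $0<\alpha<n$, $0<\beta\le n$, and let $Q_0\subset\mathbb{R}^n$ be a finite cube. Assume $f\in \mathrm{BMO}(Q_0)$ with $\operatorname{supp}(f)\subset Q_0$. Then there exists a constant $C>0$, depending only on $\alpha$, $\beta$ and $n$, such that $$\|\mathcal{M}_\alpha f\|_{\mathrm{BLO}^\beta(Q_0)}\le C\,\ell(Q_0)^\alpha\,\|f\|_{\mathrm{BMO}(Q_0)}.$$
   Context: All cubes are open with sides parallel to the coordinate axes; $\ell(Q)$ is the side length of $Q$. A function with $\operatorname{supp}(f)\subset Q_0$ is regarded as a function on $\mathbb{R}^n$ vanishing outside $Q_0$. Uncentered fractional maximal function: $\mathcal{M}_\alpha f(x)=\sup_{Q\ni x}\ell(Q)^{-(n-\alpha)}\int_Q|f(y)|\,dy$, supremum over all open cubes $Q\subset\mathbb{R}^n$ containing $x$. $\mathrm{BMO}(Q_0)$ is the space of locally integrable $f$ with $\|f\|_{\mathrm{BMO}(Q_0)}=\sup_Q\inf_{c\in\mathbb{R}}\ell(Q)^{-n}\int_Q|f(y)-c|\,dy<\infty$, supremum over all finite subcubes $Q$ of $Q_0$ parallel to $Q_0$. Dyadic Hausdorff content: with $\mathcal{D}_0=\{2^k(l+[0,1)^n):k\in\mathbb{Z},\,l\in\mathbb{Z}^n\}$, for $E\subset\mathbb{R}^n$, $\mathcal{H}_\infty^\beta(E)=\inf\{\sum_{i=1}^\infty\ell(Q_i)^\beta: E\subset\bigcup_i Q_i,\ Q_i\in\mathcal{D}_0\}$. For $f:\Omega\to[0,\infty]$,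 the Choquet integral is $\int_\Omega f\,d\mathcal{H}_\infty^\beta=\int_0^\infty\mathcal{H}_\infty^\beta(\{x\in\Omega:f(x)>t\})\,dt$. For a function $g$ and $A\subset\mathbb{R}^n$, $\operatorname{ess\,inf}_{\beta,A}\,g=\sup\{c\in\mathbb{R}:\mathcal{H}_\infty^\beta(\{x\in A: g(x)<c\})=0\}$. Define $$\|g\|_{\mathrm{BLO}^\beta(Q_0)}=\sup_Q\frac{1}{\mathcal{H}_\infty^\beta(Q)}\int_Q\big(g(x)-\operatorname{ess\,inf}_{\beta,Q}\,g\big)\,d\mathcal{H}_\infty^\beta(x),$$ supremum over all finite subcubes $Q$ of $Q_0$ parallel to $Q_0$. *)

(* Defs.v *)
From HB Require Import structures.
From mathcomp Require Import all_boot all_order all_algebra.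
From mathcomp Require Import all_classical all_reals all_analysis.
Import Order.TTheory GRing.Theory Num.Theory.
Import numFieldNormedType.Exports.

Set Implicit Arguments.
Unset Strict Implicit.
Unset Printing Implicit Defensive.

Local Open Scope classical_set_scope.
Local Open Scope ring_scope.
Local Open Scope ereal_scope.

(* R^d is 'rV[R]_d with d = n.+1, so that d >= 1.  For d = 0 there is no empty
   box, and the covering infimum below would not vanish on the empty set. *)

Section cover_content.
Context {R : realType} {T I : Type} (G : I -> set T) (w : I -> R).

Definition cover_content (E : set T) : \bar R :=
  ereal_inf [set \sum_(k <oo) (w (F k))%:E |
             F in [set F : nat -> I | E `<=` \bigcup_k G (F k)]].

Hypothesis w_ge0 : forall i, (0 <= w i)%R.

Lemma cover_content_ge0 E : 0 <= cover_content E.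
Proof.
apply: le_ereal_inf_tmp => _ [F EF <-].
by apply: nneseries_ge0 => k _ _; rewrite lee_fin.
Qed.

Lemma le_cover_content : {homo cover_content : A B / A `<=` B >-> A <= B}.
Proof.
move=> A B AB; apply/ereal_inf_le_tmp => _ [F BF <-].
by exists F => //; exact: subset_trans BF.
Qed.

Lemma cover_content_sigma_subadditive : sigma_subadditive cover_content.
Proof.
move=> A; have [[i ioo]|] := pselect (exists i, cover_content (A i) = +oo).
  rewrite (eseries_pinfty _ _ ioo) ?leey// => n _.
  by rewrite -ltNye (lt_le_trans _ (cover_content_ge0 _)).
rewrite -forallNE => Aoo.
suff add2e (e : {posnum R}) : cover_content (\bigcup_n A n) <=
    \sum_(i <oo) cover_content (A i) + e%:num%:E.
  by apply/lee_addgt0Pr => _/posnumP[].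
rewrite (le_trans _ (epsilon_trick _ _ _))//; last first.
  by move=> n; exact: cover_content_ge0.
pose P n (B : nat -> I) := A n `<=` \bigcup_k G (B k) /\
  \sum_(k <oo) (w (B k))%:E <=
    cover_content (A n) + (e%:num / (2 ^ n.+1)%:R)%:E.
have [B PB] : {B : nat -> nat -> I & forall n, P n (B n)}.
  apply: (@choice _ _ P) => n; rewrite /P /cover_content.
  set S := (X in ereal_inf X); move infS : (ereal_inf S) => iS.
  case: iS infS => [r Sr|Soo|Soo].
  - have en1 : (0 < e%:num / (2 ^ n.+1)%:R)%R by [].
    have /(lb_ereal_inf_adherent en1) : ereal_inf S \is a fin_num by rewrite Sr.
    move=> [x [B AnB muBx] xS].
    by exists B; split => //; rewrite muBx -Sr; exact/ltW.
  - by have := Aoo n; rewrite /cover_content Soo.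
  - suff : lbound S 0 by move/le_ereal_inf_tmp; rewrite Soo.
    move=> /= _ [B AnB <-]; apply: nneseries_ge0 => k _ _.
    by rewrite lee_fin.
pose v := fun x : nat * nat => (w (uncurry B x))%:E.
have v_ge0 x : 0 <= v x by rewrite lee_fin.
apply: (@le_trans _ _ (\esum_(i in setT) v i)).
  apply: ereal_inf_lbound => /=.
  have /card_esym/ppcard_eqP[f] := card_nat2.
  exists (uncurry B \o f).
    apply: (@subset_trans _  (\bigcup_n \bigcup_k G (B n k))) => [t [i _]|].
      by move=> /((PB i).1) -[j _ ?]; exists i => //; exists j.
    move=> t [i _ [j _ Bijt]]; exists (f^-1%FUN (i, j)) => //=.
    by rewrite invK ?inE.
  rewrite (_ : (fun n => _) = (fun n => \sum_(0 <= k < n) v (f k)))//.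
  rewrite -(esum_pred_image v _ xpredT) ?[fun=> _]set_true//.
  by rewrite image_eq.
rewrite (_ : esum _ _ = \sum_(i <oo) \sum_(j <oo ) (w (B i j))%:E); last first.
  pose J : nat -> set (nat * nat) := fun i => [set (i, j) | j in setT].
  rewrite (_ : setT = \bigcup_k J k); last first.
    by rewrite predeqE => -[a b]; split => // _; exists a => //; exists b.
  rewrite esum_bigcupT /=; last 2 first.
    - apply/trivIsetP => i j _ _ ij.
      rewrite predeqE => -[n m] /=; split => //= -[] [_] _ [<-{n} _].
      by move=> [m' _] [] /esym/eqP; rewrite (negbTE ij).
    - by move=> x; exact: v_ge0.
  rewrite -(image_id [set: nat]) -fun_true esum_pred_image//; last first.
    by move=> n _; exact: esum_ge0.
  apply: eq_eseriesr => /= j _.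
  rewrite -(esum_pred_image v (pair j) predT)//=; last first.
    by move=> ? ? _ _; exact: (@can_inj _ _ _ snd).
  by congr esum; rewrite predeqE => -[a b]; split; move=> [i _ <-]; exists i.
apply: lee_lim.
- apply: is_cvg_nneseries => n *.
  by apply: nneseries_ge0 => m *; exact: (v_ge0 (n, m)).
- apply: is_cvg_nneseries => n *; apply: adde_ge0 => //.
  exact: cover_content_ge0.
- by near=> n; apply: lee_sum => i _; exact: (PB i).2.
Unshelve. all: by end_near. Qed.

End cover_content.

Section lebesgue_measure_Rn.
Context {R : realType} {n : nat}.

Definition box (ab : 'rV[R]_n.+1 * 'rV[R]_n.+1) : set 'rV[R]_n.+1 :=
  [set x | forall i, (ab.1 ord0 i <= x ord0 i < ab.2 ord0 i)%R].

Definition box_volume (ab : 'rV[R]_n.+1 * 'rV[R]_n.+1) : R :=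
  (\prod_i Num.max 0 (ab.2 ord0 i - ab.1 ord0 i))%R.

Lemma box_volume_ge0 ab : (0 <= box_volume ab)%R.
Proof. by apply: prodr_ge0 => i _; rewrite le_max lexx. Qed.

Definition lebesgue_outer : set 'rV[R]_n.+1 -> \bar R :=
  cover_content box box_volume.

Lemma lebesgue_outer0 : lebesgue_outer set0 = 0.
Proof.
apply/eqP; rewrite eq_le (cover_content_ge0 _ box_volume_ge0) andbT.
apply: ereal_inf_lbound; exists (fun=> (0, 0)%R) => //.
rewrite eseries0// => k _ _; congr EFin.
by rewrite /box_volume big_ord_recl/= subrr maxxx mul0r.
Qed.

HB.instance Definition _ := isOuterMeasure.Build R 'rV[R]_n.+1 lebesgue_outer
  lebesgue_outer0 (@cover_content_ge0 _ _ _ box _ box_volume_ge0)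
  (@le_cover_content _ _ _ box box_volume)
  (@cover_content_sigma_subadditive _ _ _ box _ box_volume_ge0).

End lebesgue_measure_Rn.

(* R^(n.+1) with the sigma-algebra of Lebesgue measurable sets *)
Definition Rn (R : realType) (n : nat) :=
  caratheodory_type (@lebesgue_outer R n).
HB.instance Definition _ (R : realType) (n : nat) := Measurable.on (Rn R n).

Definition lebesgue_Rn (R : realType) (n : nat) : set (Rn R n) -> \bar R :=
  @lebesgue_outer R n.
Arguments lebesgue_Rn {R n}.
HB.instance Definition _ (R : realType) (n : nat) :=
  isMeasure.Build _ (Rn R n) R lebesgue_Rn
    (@caratheodory_measure0 _ _ (@lebesgue_outer R n))
    (@caratheodory_measure_ge0 _ _ (@lebesgue_outer R n))
    (@caratheodory_measure_sigma_additive _ _ (@lebesgue_outer R n)).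

Section cubes_and_norms.
Context {R : realType} {n : nat}.
Implicit Types (a : 'rV[R]_n.+1) (l alpha beta : R) (f : Rn R n -> R).
Implicit Types (A D E Q : set 'rV[R]_n.+1) (g : 'rV[R]_n.+1 -> \bar R).

Definition cube a l : set 'rV[R]_n.+1 :=
  [set x | forall i, (a ord0 i < x ord0 i < a ord0 i + l)%R].

Definition frac_maximal alpha f : 'rV[R]_n.+1 -> \bar R := fun x =>
  ereal_sup [set (q.2 `^ (- (n.+1%:R - alpha)))%:E *
                 \int[lebesgue_Rn]_(y in cube q.1 q.2) `|f y|%:E |
             q in [set q : 'rV[R]_n.+1 * R | (0 < q.2)%R /\ cube q.1 q.2 x]].

Definition locally_integrable_Rn D f : Prop :=
  measurable_fun (D : set (Rn R n)) f /\
  forall K : set 'rV[R]_n.+1, K `<=` D -> compact K ->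
    \int[lebesgue_Rn]_(y in K) `|f y|%:E < +oo.

Definition subcubes Q0 : set ('rV[R]_n.+1 * R) :=
  [set q | (0 < q.2)%R /\ cube q.1 q.2 `<=` Q0].

Definition BMO_norm Q0 f : \bar R :=
  ereal_sup [set ereal_inf
      [set (q.2 ^- n.+1)%:E *
           \int[lebesgue_Rn]_(y in cube q.1 q.2) `|f y - c|%:E |
       c in [set: R]] |
    q in subcubes Q0].

Definition in_BMO Q0 f : Prop :=
  locally_integrable_Rn Q0 f /\ BMO_norm Q0 f < +oo.

(* kz stands for the cube 2^k (z + [0,1)^(n.+1)) *)
Definition dyadic_cube (kz : int * 'rV[int]_n.+1) : set 'rV[R]_n.+1 :=
  [set x | forall i, (2 ^ kz.1 * (kz.2 ord0 i)%:~R <= x ord0 i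
                      < 2 ^ kz.1 * ((kz.2 ord0 i)%:~R + 1))%R].

Definition hausdorff_content beta : set 'rV[R]_n.+1 -> \bar R :=
  cover_content dyadic_cube (fun kz => ((2 ^ kz.1) `^ beta)%R).

(* The difference g - ess inf below may be negative on a set of content zero;
   only levels t > 0 enter the integral. *)
Definition choquet beta D g : \bar R :=
  \int[lebesgue_measure]_(t in `]0%R, +oo[)
    hausdorff_content beta [set x | D x /\ t%:E < g x].

Definition ess_inf_content beta A g : \bar R :=
  ereal_sup [set c%:E | c in
    [set c : R | hausdorff_content beta [set x | A x /\ g x < c%:E] = 0]].

Definition BLO_norm beta Q0 g : \bar R :=
  ereal_sup [set
      (let Q := cube q.1 q.2 in
       choquet beta Q (fun x => g x - ess_inf_content beta Q g)
         / hausdorff_content beta Q) |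
    q in subcubes Q0].

End cubes_and_norms.

(* Main.v *)
Require Import Defs.
From mathcomp Require Import all_boot all_order all_algebra.
From mathcomp Require Import all_classical all_reals all_analysis.
From mathcomp Require Import measurable_realfun ring lra.
Import Order.TTheory GRing.Theory Num.Theory.
Import numFieldNormedType.Exports.

Local Open Scope classical_set_scope.
Local Open Scope ring_scope.

(** Over the whole of Q0 the function M_alpha f oscillates by at most
    C * l0^alpha * ||f||_BMO, which is far more than the BLO bound asks for: once
    m <= g <= m + B on Q0, the essential infimum of g over any subset Q is at
    least m, the superlevel sets of g - ess inf g are empty beyond B, and the
    normalised Choquet integral over Q is at most B (BLO_norm_le_oscillation).

    For the oscillation, write A(R) = r^alpha times the mean of |f| over a cube R
    of side r.  Then M_alpha f >= m := A(Q0) on Q0, because Q0 itself competes in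
    the supremum.  Conversely, a competitor R meeting Q0 may be assumed to lie
    inside Q0: since f vanishes outside Q0, a cube no longer than Q0 can be pushed
    inside Q0 without losing mass (cube_shift), and a longer one does worse than
    Q0 because alpha < n.  For R inside Q0, passing from R to a cube of twice the
    side raises the mean by at most a multiple of N := ||f||_BMO
    (cube_mean_doubling).  Passing to the weighted means turns this into the
    contraction A(R) <= 2^(-alpha) A(R') + C N l0^alpha, where R' is the larger
    cube, and since alpha > 0 iterating it up to Q0 costs only a convergent
    geometric series (frac_mean_le): A(R) <= m + K N l0^alpha, where
    K = 2^(-alpha) K + C.

    The doubling step compares a constant with its integral over a cube, so it
    needs that the outer measure generated by boxes gives a cube of side l the
    measure l^n, and that cubes are Caratheodory measurable.  That countably many
    boxes covering a cube have total volume at least l^n is obtained without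
    compactness: the covering says that a product of indicator functions is at
    most a series of such products, and integrating one coordinate after the
    other against the Lebesgue measure of the line turns these products of
    indicators into products of lengths (le_tensor_integral). *)

(** * The measure of cubes *)

(** Inequalities between sums of tensor products survive integration of all the
    variables.  The weights c and e are what makes the induction on the dimension
    go through: freezing the first variable at t multiplies them by the values at
    t of the first factors. *)
Lemma le_tensor_integral {disp} {T : measurableType disp} {R : realType}
    (mu : {measure set T -> \bar R}) {d : nat} (c : R) (u : 'I_d -> T -> R)
    (U : 'I_d -> R) (e : nat -> R) (v : nat -> 'I_d -> T -> R)
    (V : nat -> 'I_d -> R) :
  0 <= c -> (forall k, 0 <= e k) ->
  (forall i t, 0 <= u i t) -> (forall k i t, 0 <= v k i t) ->
  (forall i, measurable_fun setT (u i)) ->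
  (forall k i, measurable_fun setT (v k i)) ->
  (forall i, \int[mu]_t (u i t)%:E = (U i)%:E)%E ->
  (forall k i, \int[mu]_t (v k i t)%:E = (V k i)%:E)%E ->
  (forall x : 'I_d -> T, ((c * \prod_i u i (x i))%:E
     <= \sum_(k <oo) (e k * \prod_i v k i (x i))%:E)%E) ->
  ((c * \prod_i U i)%:E <= \sum_(k <oo) (e k * \prod_i V k i)%:E)%E.
Proof.
elim: d c u U e v V => [|d IH] c u U e v V c0 e0 u0 v0 mu_ mv_ iu iv le_uv.
  have x0 : 'I_0 -> T by case.
  move: (le_uv x0); rewrite !big_ord0; under eq_eseriesr do rewrite big_ord0.
  by under [in X in _ -> X]eq_eseriesr do rewrite big_ord0.
have U0 i : 0 <= U i.
  by rewrite -lee_fin -iu; apply: integral_ge0 => t _; rewrite lee_fin.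
have V0 k i : 0 <= V k i.
  by rewrite -lee_fin -iv; apply: integral_ge0 => t _; rewrite lee_fin.
pose PU := \prod_(i < d) U (lift ord0 i).
pose PV k := \prod_(i < d) V k (lift ord0 i).
have PU0 : 0 <= PU by apply: prodr_ge0.
have PV0 k : 0 <= PV k by apply: prodr_ge0.
have slice t : ((u ord0 t)%:E * (c * PU)%:E
    <= \sum_(k <oo) ((v k ord0 t)%:E * (e k * PV k)%:E))%E.
  have := IH (c * u ord0 t) (fun i => u (lift ord0 i)) (fun i => U (lift ord0 i))
    (fun k => e k * v k ord0 t) (fun k i => v k (lift ord0 i))
    (fun k i => V k (lift ord0 i)).
  rewrite -EFinM mulrCA mulrA -/PU => IHt.
  under eq_eseriesr do rewrite -EFinM mulrCA mulrA.
  apply: IHt => // [|k|x]; [exact: mulr_ge0|exact: mulr_ge0|].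
  have := le_uv (fun i => oapp x t (unlift ord0 i)).
  rewrite big_ord_recl unlift_none /=.
  under eq_bigr do rewrite liftK /=.
  rewrite mulrA; under eq_eseriesr => k _.
    rewrite big_ord_recl unlift_none /=.
    under eq_bigr do rewrite liftK /=.
    rewrite mulrA; over.
  by [].
rewrite big_ord_recl mulrCA EFinM -/PU -iu.
under eq_eseriesr do rewrite big_ord_recl mulrCA EFinM -/(PV _) -iv.
have mvk k : measurable_fun setT (fun t => (v k ord0 t)%:E * (e k * PV k)%:E)%E.
  by apply: emeasurable_funM => //; exact/measurable_EFinP.
rewrite -ge0_integralZr//; last 3 first.
- exact/measurable_EFinP.
- by move=> t _; rewrite lee_fin.
- by rewrite lee_fin mulr_ge0.
under eq_eseriesr => k _.
  rewrite -ge0_integralZr//; last 3 first.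
  - exact/measurable_EFinP.
  - by move=> t _; rewrite lee_fin.
  - by rewrite lee_fin mulr_ge0.
  over.
(* What is left is the inequality slice, integrated in the first variable. *)
rewrite -integral_nneseries//; last first.
  by move=> k t _; rewrite -EFinM lee_fin !mulr_ge0.
apply: ge0_le_integral => //.
- by move=> t _; rewrite -EFinM lee_fin !mulr_ge0.
- by apply: emeasurable_funM => //; exact/measurable_EFinP.
- apply: ge0_emeasurable_sum => // k t _ _.
  by rewrite -EFinM lee_fin !mulr_ge0.
Qed.

Section lebesgue_Rn_cubes.
Context {R : realType} {n : nat}.
Implicit Types (a x : 'rV[R]_n.+1) (l : R).

Lemma integral_indic_itv (i : interval R) (l : R) :
  lebesgue_measure [set` i] = l%:E ->
  (\int[lebesgue_measure]_t (\1_[set` i] t : R)%:E = l%:E)%E.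
Proof. by move=> <-; rewrite integral_indic ?setIT. Qed.

(** The hard inequality for the volume: a point of the cube lies in some box of the
    covering, which makes one term of the series of products equal to 1. *)
Lemma le_lebesgue_outer_cube a l : 0 <= l ->
  ((l ^+ n.+1)%:E <= lebesgue_outer (cube a l))%E.
Proof.
move=> l0; apply: le_ereal_inf_tmp => _ [F cover <-].
pose u i : R -> R := \1_`]a ord0 i, a ord0 i + l[.
pose v k i : R -> R := \1_`[(F k).1 ord0 i, (F k).2 ord0 i[.
have := @le_tensor_integral _ _ _ lebesgue_measure n.+1 1 u (fun=> l) (fun=> 1) v
  (fun k i => Num.max 0 ((F k).2 ord0 i - (F k).1 ord0 i)).
rewrite mul1r prodr_const card_ord; under eq_eseriesr do rewrite mul1r.
apply=> //.
- by move=> i; exact: measurable_indic.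
- by move=> k i; exact: measurable_indic.
- move=> i; apply: integral_indic_itv.
  rewrite lebesgue_measure_itv/= lte_fin -EFinB.
  by case: ltP => h; congr EFin; lra.
- move=> k i; apply: integral_indic_itv.
  rewrite lebesgue_measure_itv/= lte_fin -EFinB.
  by case: ltP => h; congr EFin; [rewrite max_r|rewrite max_l]; lra.
- move=> x; have vx0 k : (0 <= (1 * \prod_i v k i (x i))%:E)%E.
    by rewrite lee_fin mul1r prodr_ge0.
  have [/forallP ux|/forallPn[i uxi]] :=
    boolP [forall i, x i \in `]a ord0 i, a ord0 i + l[].
    have [k _ Fkx] : (\bigcup_k box (F k)) (\row_i x i).
      by apply: cover => i; have := ux i; rewrite in_itv/= mxE.
    rewrite (nneseriesD1 (n := k))//= (le_trans _ (leeDl _ _))//; last first.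
      exact: nneseries_ge0.
    rewrite lee_fin !big1//= => i _.
    + by rewrite /v indicE mem_set//=; have := Fkx i; rewrite in_itv/= mxE.
    + by rewrite /u indicE mem_set//=; exact: ux.
  rewrite (bigD1 i)//= {1}/u indicE memNset ?mul0r ?mulr0//.
    exact: nneseries_ge0.
  exact/negP.
Qed.

(** The half-open box on the same corners, followed by empty boxes, is a covering. *)
Lemma lebesgue_outer_cube_le a l : 0 <= l ->
  (lebesgue_outer (cube a l) <= (l ^+ n.+1)%:E)%E.
Proof.
move=> l0.
pose F k : 'rV[R]_n.+1 * 'rV[R]_n.+1 :=
  if k is 0%N then (a, \row_i (a ord0 i + l)) else (0, 0).
apply: (@le_trans _ _ (\sum_(k <oo) (box_volume (F k))%:E)%E).
  apply: ereal_inf_lbound; exists F => // x ax; exists 0%N => // i; rewrite mxE.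
  by have /andP[/ltW-> ->] := ax i.
rewrite (nneseriesD1 (n := 0%N))//; last by move=> k _; rewrite lee_fin box_volume_ge0.
rewrite eseries0 ?adde0; last first.
  move=> [|k] //= _ _; congr EFin.
  by rewrite /box_volume big_ord_recl/= subrr maxxx mul0r.
rewrite lee_fin /box_volume (eq_bigr (fun=> l)) ?prodr_const ?card_ord// => i _.
by rewrite mxE addrC addKr max_r.
Qed.

Definition cut_below (i : 'I_n.+1) (c : R) (ab : 'rV[R]_n.+1 * 'rV[R]_n.+1) :=
  (ab.1, \row_j (if j == i then Num.min (ab.2 ord0 j) c else ab.2 ord0 j)).

Definition cut_above (i : 'I_n.+1) (c : R) (ab : 'rV[R]_n.+1 * 'rV[R]_n.+1) :=
  (\row_j (if j == i then Num.max (ab.1 ord0 j) c else ab.1 ord0 j), ab.2).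

Lemma box_volume_cut i c ab :
  box_volume ab = box_volume (cut_below i c ab) + box_volume (cut_above i c ab).
Proof.
rewrite /box_volume (bigD1 i)//= [X in _ = X + _](bigD1 i)//=.
rewrite [X in _ = _ + X](bigD1 i)//= !mxE eqxx.
rewrite [X in _ = _ * X + _](eq_bigr
  (fun j => Num.max 0 (ab.2 ord0 j - ab.1 ord0 j))); last first.
  by move=> j /negbTE ji; rewrite mxE ji.
rewrite [X in _ + _ * X](eq_bigr
  (fun j => Num.max 0 (ab.2 ord0 j - ab.1 ord0 j))); last first.
  by move=> j /negbTE ji; rewrite mxE ji.
rewrite -mulrDl; congr (_ * _).
move: (ab.1 _ _) (ab.2 _ _) => p q.
case: (leP q c) => qc; case: (leP p c) => pc;
  case: (leP 0 (q - p)) => qp; case: (leP 0 (c - p)) => cp;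
  case: (leP 0 (q - c)) => cq; lra.
Qed.

(** Cutting every box of a covering of X along the hyperplane x_i = c yields
    coverings of the two parts of X with the same total volume. *)
Lemma lebesgue_outer_caratheodory_lt i c :
  (@lebesgue_outer R n).-caratheodory [set x | x ord0 i < c].
Proof.
apply: le_caratheodory_measurable => X.
apply: le_ereal_inf_tmp => _ [F cover <-].
under eq_eseriesr do rewrite (box_volume_cut i c) EFinD.
rewrite nneseriesD; [|by move=> k _ _; rewrite lee_fin box_volume_ge0..].
apply: leeD; apply: ereal_inf_lbound.
- exists (cut_below i c \o F) => // x [Xx xc]; have [k _ Fx] := cover x Xx.
  exists k => // j; rewrite mxE; have := Fx j.
  by case: eqP => // ->; rewrite lt_min xc andbT.
- exists (cut_above i c \o F) => // x [Xx xc]; have [k _ Fx] := cover x Xx.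
  exists k => // j; rewrite mxE; have := Fx j.
  case: eqP => // ->; rewrite ge_max => /andP[-> ->].
  by rewrite andbT/= leNgt; exact/negP.
Qed.

Lemma measurable_cube a l : measurable (cube a l : set (Rn R n)).
Proof.
have mlt i c : measurable ([set x | x ord0 i < c] : set (Rn R n)).
  exact: lebesgue_outer_caratheodory_lt.
have mgt i c : measurable ([set x | c < x ord0 i] : set (Rn R n)).
  rewrite (_ : [set x | _] = \bigcup_k ~` [set x | x ord0 i < c + k.+1%:R^-1]).
    by apply: bigcupT_measurable => k; exact: measurableC.
  apply/seteqP; split => x /=.
    rewrite -subr_gt0 => /ltr_add_invr[k]; rewrite add0r => kx; exists k => //=.
    by apply/negP; rewrite -leNgt -lerBrDl ltW.
  move=> [k _ /negP]; rewrite -leNgt; apply: lt_le_trans.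
  by rewrite ltrDl invr_gt0.
rewrite (_ : cube a l = \bigcap_(i in [set: 'I_n.+1])
    ([set x | a ord0 i < x ord0 i] `&` [set x | x ord0 i < a ord0 i + l])).
  by apply: fin_bigcap_measurable => // i _; exact: measurableI.
by apply/seteqP; split=> x /= ax i => [_|]; [exact/andP|exact/andP/ax].
Qed.

End lebesgue_Rn_cubes.

(** * From oscillation to the BLO norm *)

Section content_side.
Context {R : realType} {n : nat}.
Implicit Types (beta : R) (g : 'rV[R]_n.+1 -> \bar R).

(** Dyadic cubes are never empty, so even the empty set is covered at a positive
    cost; a sequence of cubes whose weights decrease geometrically makes this
    cost arbitrarily small, as beta is positive. *)
Lemma hausdorff_content0 beta : 0 < beta ->
  hausdorff_content beta (set0 : set 'rV[R]_n.+1) = 0%E.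
Proof.
move=> b0; apply/eqP; rewrite eq_le cover_content_ge0 ?andbT; last first.
  by move=> kz; exact: powR_ge0.
apply/lee_addgt0Pr => e e0; rewrite add0e.
have small (y : R) : 0 < y -> exists k : int, ((2 : R) ^ k) `^ beta <= y.
  move=> y0; pose z := y `^ beta^-1; have z0 : 0 < z by exact: powR_gt0.
  exists (- (Num.bound z^-1)%:Z).
  have -> : y = z `^ beta by rewrite -powRrM mulVf ?gt_eqF// powRr1 ?ltW.
  apply: ge0_ler_powR; rewrite ?nnegrE ?ltW ?exprz_gt0//.
  rewrite -exprnN -[ltRHS]invrK ltf_pV2 ?posrE ?exprn_gt0 ?invr_gt0//.
  rewrite (lt_trans (archi_boundP _)) ?invr_ge0 ?ltW//.
  by rewrite -natrX ltr_nat ltn_expl.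
have /choice[k hk] : forall m : nat, exists k : int,
    ((2 : R) ^ k) `^ beta <= e / (2 ^ m.+1)%:R.
  by move=> m; apply: small; rewrite divr_gt0// ltr0n expn_gt0.
apply: (@le_trans _ _ (\sum_(m <oo) (((2 : R) ^ k m) `^ beta)%:E)%E).
  by apply: ereal_inf_lbound; exists (fun m => (k m, 0)).
apply: (le_trans _ (epsilon_trick0 xpredT (ltW e0))).
by apply: lee_nneseries => m _ //; rewrite lee_fin ?powR_ge0.
Qed.

Lemma le_ess_inf_content beta (A : set 'rV[R]_n.+1) g (m : R) : 0 < beta ->
  (forall x, A x -> (m%:E <= g x)%E) -> (m%:E <= ess_inf_content beta A g)%E.
Proof.
move=> b0 mg; apply: ereal_sup_ubound; exists m => //=.
rewrite (_ : [set x | _] = set0) ?hausdorff_content0//.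
by apply/seteqP; split => x //= [/mg]; rewrite leNgt => /negP.
Qed.

(** The integral of a nonnegative function is a supremum over the simple functions
    below it, hence is monotone even on functions that are not measurable.  It
    is applied to the level function of a Choquet integral. *)
Lemma le_nnintegral {disp} {T : measurableType disp}
    (mu : {measure set T -> \bar R}) (D : set T) (f g : T -> \bar R) :
  (forall x, D x -> 0 <= f x)%E -> (forall x, D x -> f x <= g x)%E ->
  (\int[mu]_(x in D) f x <= \int[mu]_(x in D) g x)%E.
Proof.
move=> f0 fg; rewrite !ge0_integralE//; last first.
  by move=> x Dx; exact: le_trans (f0 x Dx) (fg x Dx).
apply: ereal_sup_le => _ [h hf <-]; exists h => // x.
by apply: le_trans (hf x) _; rewrite /patch; case: ifPn => // /set_mem/fg.
Qed.

Lemma choquet_le beta (Q : set 'rV[R]_n.+1) g (B : R) : 0 < beta -> 0 <= B ->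
  (forall x, Q x -> g x <= B%:E)%E ->
  (choquet beta Q g <= B%:E * hausdorff_content beta Q)%E.
Proof.
move=> b0 B0 gB; pose h := hausdorff_content beta Q.
have H0 (A : set 'rV[R]_n.+1) : (0 <= hausdorff_content beta A)%E.
  by apply: cover_content_ge0 => kz; exact: powR_ge0.
(* Levels t >= B are not reached; at the others the content is at most that of Q. *)
apply: (@le_trans _ _ (\int[lebesgue_measure]_(t in `]0%R, +oo[)
    ((fun=> h) \_ `]0%R, B[) t)%E).
  apply: le_nnintegral => // t /=; rewrite in_itv/= andbT => t0.
  rewrite /patch; case: ifPn => tB.
    by apply: le_cover_content => x [].
  rewrite (_ : [set x | _] = set0) ?hausdorff_content0//.
  apply/seteqP; split => x //= [/gB gxB tgx].
  move/negP: tB; apply; rewrite inE/= in_itv/= t0/= -lte_fin.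
  exact: lt_le_trans tgx gxB.
rewrite -integral_mkcondr integral_cst//; last exact: measurableI.
rewrite [leLHS]muleC; apply: lee_wpmul2r; first exact: H0.
rewrite (_ : _ `&` _ = [set` `]0, B[]); last first.
  apply/seteqP; split=> t /=; rewrite !in_itv/=; first by case.
  by move=> /andP[-> ->].
rewrite [leLHS]lebesgue_measure_itv/= lte_fin -EFinB subr0.
by case: ifP => _ //; rewrite lee_fin.
Qed.

Lemma BLO_norm_le_oscillation beta (Q0 : set 'rV[R]_n.+1) g (m B : R) :
  0 < beta -> 0 <= B ->
  (forall x, Q0 x -> m%:E <= g x /\ g x <= (m + B)%:E)%E ->
  (BLO_norm beta Q0 g <= B%:E)%E.
Proof.
move=> b0 B0 mgB; apply: ge_ereal_sup => _ [[a l] [/= l0 sub] <-] /=.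
set Q := cube a l; set h := hausdorff_content beta Q.
have H0 : (0 <= h)%E by apply: cover_content_ge0 => kz; exact: powR_ge0.
have le_ch : (choquet beta Q (fun x => g x - ess_inf_content beta Q g)%E
    <= B%:E * h)%E.
  apply: choquet_le => // x /sub/mgB[_ gB].
  apply: (@le_trans _ _ ((m + B)%:E - m%:E)%E); last by rewrite -EFinB lee_fin; lra.
  by apply: leeB => //; apply: le_ess_inf_content => // y /sub/mgB[].
(* The quotient h / h is 1, or 0 when the content h is 0 or +oo: 0^-1 = +oo,
   +oo^-1 = 0 and 0 * +oo = 0. *)
apply: (@le_trans _ _ (B%:E * h / h)%E).
  by apply: lee_wpmul2r => //; rewrite inve_ge0.
rewrite -muleA; case: h H0 {le_ch} => [r| |] //= H0; last first.
  by rewrite invey mule0 mule0 lee_fin.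
have [->|r0] := eqVneq r 0; first by rewrite mul0e mule0 lee_fin.
by rewrite divee ?mule1// eqe.
Qed.

End content_side.

(** * Fractional means over subcubes *)

Section maximal_side.
Context {R : realType} {n : nat}.
Implicit Types (a b : 'rV[R]_n.+1) (l r s c N : R) (f : 'rV[R]_n.+1 -> R).

Local Notation "'int_cube' a l f" :=
  (\int[lebesgue_Rn]_(y in (cube a l : set (Rn R n))) `|f y|%:E)%E
  (at level 10, a, l, f at level 9).

(** The inclusion of cube b r in cube a l, read on the corners; this is the form
    in which cubes can be moved and enlarged by linear arithmetic. *)
Definition cube_fits a l b r :=
  forall i, a ord0 i <= b ord0 i /\ b ord0 i + r <= a ord0 i + l.

Lemma cube_fits_subset a l b r : cube_fits a l b r -> cube b r `<=` cube a l.
Proof.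
move=> fit x bx i; have [ab ba] := fit i; have /andP[bx1 bx2] := bx i.
by rewrite (le_lt_trans ab bx1) (lt_le_trans bx2 ba).
Qed.

Lemma cube_fits_double a l b r : 0 < r -> 2 * r <= l -> cube_fits a l b r ->
  exists2 b', cube_fits a l b' (2 * r) & cube b r `<=` cube b' (2 * r).
Proof.
move=> r0 rl fit.
exists (\row_i Num.max (a ord0 i) (b ord0 i - r)).
  move=> i; rewrite mxE; have [? ?] := fit i.
  by case: (leP (a ord0 i) (b ord0 i - r)) => ?; split; lra.
apply: cube_fits_subset => i; rewrite mxE; have [? ?] := fit i.
by case: (leP (a ord0 i) (b ord0 i - r)) => ?; split; lra.
Qed.

(** Clamping the corner of a short cube coordinatewise moves it inside cube a l
    and keeps the points it had there. *)
Lemma cube_shift a l b r : 0 < r -> r <= l ->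
  exists2 b', cube_fits a l b' r & cube a l `&` cube b r `<=` cube b' r.
Proof.
move=> r0 rl.
exists (\row_i Num.max (a ord0 i) (Num.min (b ord0 i) (a ord0 i + l - r))).
  move=> i; rewrite mxE.
  case: (leP (b ord0 i) (a ord0 i + l - r)) => ?.
    by case: (leP (a ord0 i) (b ord0 i)) => ?; split; lra.
  by case: (leP (a ord0 i) (a ord0 i + l - r)) => ?; split; lra.
move=> x [ax bx] i; have /andP[? ?] := ax i; have /andP[? ?] := bx i.
rewrite mxE; case: (leP (b ord0 i) (a ord0 i + l - r)) => ?.
  by case: (leP (a ord0 i) (b ord0 i)) => ?; apply/andP; split; lra.
by case: (leP (a ord0 i) (a ord0 i + l - r)) => ?; apply/andP; split; lra.
Qed.

Lemma le_int_cube a l b s f : measurable_fun (cube a l : set (Rn R n)) f ->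
  cube b s `<=` cube a l -> (int_cube b s f <= int_cube a l f)%E.
Proof.
move=> mf sub.
apply: ge0_subset_integral.
- exact: measurable_cube.
- exact: measurable_cube.
- exact/measurable_EFinP/measurableT_comp.
- by move=> x _; rewrite lee_fin.
- exact: sub.
Qed.

Lemma lebesgue_Rn_cube a l : 0 <= l ->
  lebesgue_Rn (cube a l : set (Rn R n)) = (l ^+ n.+1)%:E.
Proof.
move=> l0; apply/eqP; rewrite eq_le lebesgue_outer_cube_le//.
exact: le_lebesgue_outer_cube.
Qed.

Lemma int_cube_cst a l c : 0 <= l ->
  int_cube a l (fun=> c) = (`|c| * l ^+ n.+1)%:E.
Proof.
move=> l0; rewrite (integral_cst _ (measurable_cube a l) (`|c|%:E)).
by rewrite EFinM; congr (_ * _)%E; exact: lebesgue_Rn_cube.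
Qed.

Lemma int_cubeD a l f g :
  measurable_fun (cube a l : set (Rn R n)) f ->
  measurable_fun (cube a l : set (Rn R n)) g ->
  (int_cube a l (fun x => f x + g x)%R <= int_cube a l f + int_cube a l g)%E.
Proof.
move=> mf mg.
have mn (h : Rn R n -> R) : measurable_fun (cube a l : set (Rn R n)) h ->
    measurable_fun (cube a l : set (Rn R n)) (fun y => `|h y|%:E).
  by move=> mh; apply/measurable_EFinP/measurableT_comp.
have n0 (h : Rn R n -> R) x : cube a l x -> (0 <= `|h x|%:E)%E.
  by rewrite lee_fin.
rewrite -(ge0_integralD _ (measurable_cube a l) (n0 f) (mn f mf) (n0 g) (mn g mg)).
apply: ge0_le_integral.
- exact: measurable_cube.
- by move=> x _; rewrite lee_fin.
- by apply: mn; exact: measurable_funD.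
- by apply: emeasurable_funD; exact: mn.
- by move=> x _; rewrite -EFinD lee_fin ler_normD.
Qed.

(** Both means are compared with the constant c.  On the smaller cube
    |f| <= |c| + |f - c|, and the integral of |f - c| over the larger cube is at
    most N * s^n <= 2^n * N * r^n.  On the larger cube |c| <= |f| + |f - c|, so
    that |c| is at most the mean of |f| plus N. *)
Lemma cube_mean_doubling a s b r c N f :
  measurable_fun (cube a s : set (Rn R n)) f ->
  0 < r -> 0 < s -> s <= 2 * r -> cube b r `<=` cube a s -> 0 <= N ->
  (int_cube a s (fun y => f y - c)%R <= (N * s ^+ n.+1)%:E)%E ->
  ((r ^- n.+1)%:E * int_cube b r f
    <= (s ^- n.+1)%:E * int_cube a s f + ((2 ^+ n.+1 + 1) * N)%:E)%E.
Proof.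
move=> mf r0 s0 sr sub N0 oscN.
have mfr := measurable_funS (measurable_cube a s) sub mf.
have mc D : measurable_fun (D : set (Rn R n)) (fun=> c) by exact: measurable_cst.
have rn0 : 0 < r ^+ n.+1 by rewrite exprn_gt0.
have sn0 : 0 < s ^+ n.+1 by rewrite exprn_gt0.
have small : (int_cube b r f <= (N * s ^+ n.+1 + `|c| * r ^+ n.+1)%:E)%E.
  rewrite EFinD -(int_cube_cst b r c (ltW r0)).
  apply: le_trans (leeD2r _ (le_trans (le_int_cube _ _ _ _ _ _ sub) oscN)); last first.
    exact: measurable_funB.
  apply: le_trans (int_cubeD _ _ _ _ (measurable_funB mfr (mc _)) (mc _)).
  by rewrite le_eqVlt; apply/orP; left; apply/eqP/eq_integral => x _; rewrite subrK.
have large : ((`|c| * s ^+ n.+1)%:E <= int_cube a s f + (N * s ^+ n.+1)%:E)%E.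
  rewrite -(int_cube_cst a s c (ltW s0)).
  apply: le_trans (leeD2l _ oscN).
  rewrite (_ : int_cube a s (fun y => f y - c) = int_cube a s (fun y => c - f y)).
    apply: le_trans (int_cubeD _ _ _ _ mf (measurable_funB (mc _) mf)).
    rewrite le_eqVlt; apply/orP; left; apply/eqP/eq_integral => x _.
    by rewrite addrC subrK.
  by apply: eq_integral => x _; rewrite distrC.
have {}large : (`|c|%:E <= (s ^- n.+1)%:E * int_cube a s f + N%:E)%E.
  have -> : N%:E = ((s ^- n.+1)%:E * (N * s ^+ n.+1)%:E)%E.
    by rewrite -EFinM mulrC mulfK ?gt_eqF.
  rewrite -muleDr//; last first.
    by rewrite ge0_adde_def// inE ?integral_ge0// lee_fin mulr_ge0// ltW.
  by rewrite lee_pdivlMl// muleC -EFinM.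
rewrite mulrDl mul1r [(_ * N + N)%R]addrC EFinD addeA.
apply: le_trans (leeD2r _ large).
rewrite lee_pdivrMl//; apply: (le_trans small).
rewrite -EFinD -EFinM lee_fin.
have : N * s ^+ n.+1 <= N * (2 ^+ n.+1 * r ^+ n.+1).
  by rewrite ler_wpM2l// -exprMn ler_pXn2r// ?nnegrE ltW// mulr_gt0.
move: (2 ^+ n.+1) (r ^+ n.+1) (s ^+ n.+1) => t u v; lra.
Qed.

(** The quantity maximised by frac_maximal. *)
Definition frac_mean (alpha : R) f b r :=
  ((r `^ (- (n.+1%:R - alpha)))%:E * int_cube b r f)%E.

Lemma frac_meanE (alpha : R) f b r : 0 < r ->
  frac_mean alpha f b r = ((r `^ alpha)%:E * ((r ^- n.+1)%:E * int_cube b r f))%E.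
Proof.
move=> r0; rewrite /frac_mean opprB powRB; last by rewrite (gt_eqF r0) implybT.
by rewrite powR_mulrn ?ltW// muleA.
Qed.

Lemma frac_mean_doubling (alpha : R) a s b r c N M f :
  measurable_fun (cube a s : set (Rn R n)) f ->
  0 < r -> 0 < s -> s <= 2 * r -> cube b r `<=` cube a s -> 0 <= N ->
  (int_cube a s (fun y => f y - c)%R <= (N * s ^+ n.+1)%:E)%E ->
  (frac_mean alpha f a s <= M%:E)%E ->
  (frac_mean alpha f b r
    <= (r `^ alpha * (M / s `^ alpha + (2 ^+ n.+1 + 1) * N))%:E)%E.
Proof.
move=> mf r0 s0 sr sub N0 oscN; rewrite !frac_meanE// => AM.
rewrite EFinM; apply: lee_wpmul2l; first by rewrite lee_fin powR_ge0.
apply: (le_trans (cube_mean_doubling _ _ _ _ _ _ _ mf r0 s0 sr sub N0 oscN)).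
rewrite EFinD; apply: leeD2r.
by rewrite mulrC EFinM lee_pdivlMl ?powR_gt0.
Qed.

(** The sum of the geometric series of ratio 2^(-alpha) whose first term is the
    error of one doubling. *)
Definition growth_const (alpha : R) : R :=
  (2 ^+ n.+1 + 1) / (1 - 2 `^ (- alpha)).

Lemma two_powRN_lt1 (alpha : R) : 0 < alpha -> (2 : R) `^ (- alpha) < 1.
Proof.
move=> alpha0; rewrite powRN invf_lt1 ?powR_gt0//.
have : (1 : R) `^ alpha < 2 `^ alpha by apply: gt0_ltr_powR; rewrite ?nnegrE ?ltr1n.
by rewrite powR1.
Qed.

Lemma growth_const_gt0 (alpha : R) : 0 < alpha -> 0 < growth_const alpha.
Proof.
by move=> alpha0; rewrite divr_gt0 ?subr_gt0 ?two_powRN_lt1.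
Qed.

Lemma growth_constE (alpha : R) : 0 < alpha ->
  growth_const alpha
  = 2 `^ (- alpha) * growth_const alpha + (2 ^+ n.+1 + 1).
Proof.
move=> alpha0; have := two_powRN_lt1 _ alpha0; rewrite /growth_const.
move: (2 `^ _) (2 ^+ n.+1 + 1) => q C q1; field.
by rewrite gt_eqF// subr_gt0.
Qed.

(** A BMO bound by N in which each subcube comes with a constant realising it; any N
    above the BMO norm is such a bound, by the choice of near-optimal constants. *)
Definition has_mean_oscillation a l f N :=
  forall b r, 0 < r -> cube_fits a l b r ->
  exists c, (int_cube b r (fun y => f y - c)%R <= (N * r ^+ n.+1)%:E)%E.

Lemma cube_fits_refl a l : cube_fits a l a l.
Proof. by move=> i; rewrite !lexx. Qed.

(** Induction on the number of doublings that bring b, r up to the side l.  The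
    bound M = m + K l^alpha N is preserved because one doubling replaces it by at
    most 2^(-alpha) M + C l^alpha N, and K = 2^(-alpha) K + C. *)
Lemma frac_mean_le (alpha : R) a l f N m :
  0 < alpha -> 0 < l -> 0 <= N -> 0 <= m ->
  measurable_fun (cube a l : set (Rn R n)) f -> has_mean_oscillation a l f N ->
  (frac_mean alpha f a l <= m%:E)%E ->
  forall b r, 0 < r -> cube_fits a l b r ->
  (frac_mean alpha f b r <= (m + growth_const alpha * l `^ alpha * N)%:E)%E.
Proof.
move=> alpha0 l0 N0 m0 mf oscN Am.
pose K := growth_const alpha; pose C := 2 ^+ n.+1 + 1 : R; pose q := 2 `^ (- alpha) : R.
have KE : K = q * K + C by exact: growth_constE.
have K0 : 0 < K by exact: growth_const_gt0.
have q0 : 0 <= q by exact: powR_ge0.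
have q1 : q < 1 by exact: two_powRN_lt1.
have C0 : 0 <= C by rewrite addr_ge0// exprn_ge0.
have CK : C <= K by rewrite KE lerDr; exact: mulr_ge0 q0 (ltW K0).
have L0 : 0 < l `^ alpha by rewrite powR_gt0.
have KN0 : 0 <= K * l `^ alpha * N.
  exact: mulr_ge0 (mulr_ge0 (ltW K0) (ltW L0)) N0.
have le_powl r : 0 < r -> r <= l -> r `^ alpha <= l `^ alpha.
  by move=> r0 rl; rewrite ge0_ler_powR ?nnegrE// ltW.
suff main (j : nat) b r : 0 < r -> cube_fits a l b r -> l <= 2 ^+ j.+1 * r ->
    (frac_mean alpha f b r <= (m + K * l `^ alpha * N)%:E)%E.
  move=> b r r0 fit; apply: (main (Num.bound (l / r))) => //.
  rewrite -ler_pdivrMr// ltW// (lt_trans (archi_boundP _)) ?divr_ge0 ?ltW//.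
  rewrite -natrX ltr_nat.
  exact: ltn_trans (ltnSn _) (ltn_expl _ (isT : (1 < 2)%N)).
elim: j b r => [|j IH] b r r0 fit lr.
  (* Twice the side reaches l: compare with cube a l itself. *)
  have [c oscc] := oscN a l l0 (cube_fits_refl a l).
  have rl : r <= l by have [] := fit ord0; lra.
  rewrite expr1 in lr.
  apply: (le_trans (frac_mean_doubling _ _ _ _ _ _ _ _ _ mf r0 l0 lr
    (cube_fits_subset _ _ _ _ fit) N0 oscc Am)).
  rewrite lee_fin -/C (@le_trans _ _ (l `^ alpha * (m / l `^ alpha + C * N)))//.
    rewrite ler_wpM2r ?le_powl// addr_ge0 ?mulr_ge0//.
    by rewrite invr_ge0 ltW.
  rewrite mulrDr mulrCA divff ?gt_eqF// mulr1 lerD2l mulrCA mulrA.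
  by rewrite ler_wpM2r// ler_wpM2r ?(ltW L0).
have [lr2|lr2] := leP l (2 * r).
  apply: IH => //; apply: (le_trans lr2); rewrite ler_wpM2r ?(ltW r0)//.
  by rewrite -[leLHS]expr1 ler_weXn2l// ler1n.
have [b' fit' sub] := cube_fits_double _ _ _ _ r0 (ltW lr2) fit.
have s0 : 0 < 2 * r by rewrite mulr_gt0.
have [c oscc] := oscN _ _ s0 fit'.
have mf' := measurable_funS (measurable_cube a l) (cube_fits_subset _ _ _ _ fit') mf.
have IHs : (frac_mean alpha f b' (2 * r) <= (m + K * l `^ alpha * N)%:E)%E.
  by apply: IH => //; rewrite mulrA -exprSr.
apply: (le_trans (frac_mean_doubling _ _ _ _ _ _ _ _ _ mf' r0 s0 (lexx _)
  sub N0 oscc IHs)).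
rewrite lee_fin -/C powRM ?(ltW r0)// invfM mulrDr.
have -> : r `^ alpha * ((m + K * l `^ alpha * N) * ((2 `^ alpha)^-1 * (r `^ alpha)^-1))
    = q * (m + K * l `^ alpha * N).
  rewrite /q powRN; have : r `^ alpha != 0 by rewrite gt_eqF// powR_gt0.
  by move: (_ `^ alpha)^-1 (r `^ alpha) (m + _) => u v w v0; field.
have le_r : r `^ alpha * (C * N) <= C * l `^ alpha * N.
  rewrite mulrCA mulrA ler_wpM2r// ler_wpM2l// le_powl//.
  by have [] := fit ord0; lra.
have qm : q * m <= m by rewrite ler_piMl// ltW.
have XE : K * l `^ alpha * N = q * (K * l `^ alpha * N) + C * l `^ alpha * N.
  by rewrite {1}KE !mulrDl !mulrA.
rewrite mulrDr -addrA; apply: lerD => //.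
by rewrite [leRHS]XE; exact: lerD.
Qed.

(** Once both integrands are extended by zero to the whole space, the comparison
    is pointwise. *)
Lemma int_cube_support a l b r b' s f : (forall x, ~ cube a l x -> f x = 0) ->
  cube a l `&` cube b r `<=` cube b' s -> (int_cube b r f <= int_cube b' s f)%E.
Proof.
move=> f0 sub; rewrite integral_mkcond [leRHS]integral_mkcond.
have nf y : (0 <= `|f y|%:E)%E by rewrite lee_fin.
have nfD (D : set (Rn R n)) y : (0 <= ((fun z => `|f z|%:E) \_ D) y)%E.
  exact: erestrict_ge0.
apply: le_nnintegral => x _; first exact: nfD.
rewrite {1}/patch; case: ifPn => [/set_mem bx|_]; last exact: nfD.
have [ax|/f0 ->] := pselect (cube a l x); last by rewrite normr0; exact: nfD.
by rewrite /patch mem_set//; apply: sub.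
Qed.

(** * The oscillation of the maximal function *)

(** The constant m is the fractional mean over Q0 itself.  It is finite since f
    differs from some constant by an integrable function on Q0. *)
Lemma frac_maximal_oscillation (alpha : R) a l f N :
  0 < alpha -> alpha < n.+1%:R ->
  0 < l -> 0 <= N -> measurable_fun (cube a l : set (Rn R n)) f ->
  has_mean_oscillation a l f N -> (forall x, ~ cube a l x -> f x = 0) ->
  exists m : R, forall x, cube a l x -> (m%:E <= frac_maximal alpha f x
    /\ frac_maximal alpha f x <= (m + growth_const alpha * l `^ alpha * N)%:E)%E.
Proof.
move=> alpha0 alphan l0 N0 mf oscN f0.
have int_fin : int_cube a l f \is a fin_num.
  have [c oscc] := oscN a l l0 (cube_fits_refl a l).
  rewrite ge0_fin_numE; last exact: integral_ge0.
  have mc : measurable_fun (cube a l : set (Rn R n)) (fun=> c) by exact: measurable_cst.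
  apply: (@le_lt_trans _ _
    (int_cube a l (fun y => f y - c)%R + int_cube a l (fun=> c))%E).
    apply: le_trans (int_cubeD _ _ _ _ (measurable_funB mf mc) mc).
    by rewrite le_eqVlt; apply/orP; left; apply/eqP/eq_integral => x _; rewrite subrK.
  by rewrite lte_add_pinfty ?(le_lt_trans oscc) ?ltry// int_cube_cst ?ltry// ltW.
have A0 : (0 <= frac_mean alpha f a l)%E.
  by rewrite mule_ge0 ?lee_fin ?powR_ge0// integral_ge0.
have [m Am] : exists m, frac_mean alpha f a l = m%:E.
  exists (fine (frac_mean alpha f a l)); rewrite fineK//.
  by rewrite fin_numM.
have m0 : 0 <= m by rewrite -lee_fin -Am.
have K0 := growth_const_gt0 _ alpha0.
exists m => x ax; split; first by rewrite -Am; apply: ereal_sup_ubound; exists (a, l).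
apply: ge_ereal_sup => _ [[b r] [/= r0 bx] <-]; rewrite -/(frac_mean alpha f b r).
have [rl|lr] := leP r l.
  have [b' fit sub] := cube_shift a l b r r0 rl.
  have Am' : (frac_mean alpha f a l <= m%:E)%E by rewrite Am.
  apply: le_trans (frac_mean_le _ _ _ _ _ _ alpha0 l0 N0 m0 mf oscN Am' _ _ r0 fit).
  apply: lee_wpmul2l; first by rewrite lee_fin powR_ge0.
  exact: int_cube_support f0 sub.
apply: (@le_trans _ _ m%:E); last first.
  rewrite lee_fin lerDl.
  exact: mulr_ge0 (mulr_ge0 (ltW K0) (powR_ge0 _ _)) N0.
rewrite -Am; apply: (@le_trans _ _
  ((r `^ (- (n.+1%:R - alpha)))%:E * int_cube a l f)%E).
  apply: lee_wpmul2l; first by rewrite lee_fin powR_ge0.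
  by apply: int_cube_support f0 _ => y [].
apply: lee_wpmul2r; first exact: integral_ge0.
rewrite lee_fin !powRN lef_pV2 ?posrE ?powR_gt0//.
by rewrite ge0_ler_powR ?nnegrE ?subr_ge0// ltW.
Qed.

End maximal_side.

Lemma BMO_has_mean_oscillation (R : realType) (n : nat) (a : 'rV[R]_n.+1) (l N : R)
    (f : 'rV[R]_n.+1 -> R) : (BMO_norm (cube a l) f < N%:E)%E ->
  has_mean_oscillation a l f N.
Proof.
move=> normN b r r0 fit.
have /ereal_inf_lt[_ [c _ <-] cN] := le_lt_trans (ereal_sup_ubound
  (ex_intro2 _ _ (b, r) (conj r0 (cube_fits_subset _ _ _ _ fit)) erefl)) normN.
exists c; move: cN => /ltW /=.
by rewrite lee_pdivrMl ?exprn_gt0// -EFinM mulrC.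
Qed.

Theorem theorem1p2 (R : realType) (n : nat) (alpha beta : R)
    (halpha0 : 0 < alpha) (halphan : alpha < n.+1%:R)
    (hbeta0 : 0 < beta) (hbetan : beta <= n.+1%:R) :
  exists2 C : R, 0 < C &
    forall (a0 : 'rV[R]_n.+1) (l0 : R) (f : 'rV[R]_n.+1 -> R),
      0 < l0 ->
      in_BMO (cube a0 l0) f ->
      (forall x, ~ cube a0 l0 x -> f x = 0) ->
      (BLO_norm beta (cube a0 l0) (frac_maximal alpha f)
        <= C%:E * (l0 `^ alpha)%:E * BMO_norm (cube a0 l0) f)%E.
Proof.
have K0 := @growth_const_gt0 R n alpha halpha0.
exists (growth_const (n := n) alpha) => // a l f l0 [[mf _] BMOfin] f0.
have BMO0 : (0 <= BMO_norm (cube a l) f)%E.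
  apply: ereal_sup_ge; eexists; first by exists (a, l) => //; split.
  apply: le_ereal_inf_tmp => _ [c _ <-].
  apply: mule_ge0; last by apply: integral_ge0 => y _; rewrite lee_fin.
  by rewrite lee_fin invr_ge0 exprn_ge0// ltW.
have : BMO_norm (cube a l) f \is a fin_num by rewrite ge0_fin_numE.
move: BMO0 BMOfin (@BMO_has_mean_oscillation R n a l ^~ f).
case: (BMO_norm _ _) => // N; rewrite lee_fin => N0 _ oscN _.
pose K := growth_const (n := n) alpha * l `^ alpha.
have KL0 : 0 < K by exact: mulr_gt0 K0 (powR_gt0 _ l0).
(* The infimum over c in the BMO norm need not be attained: N is enlarged by e / K,
   which costs e in the conclusion. *)
rewrite -!EFinM -/K; apply/lee_addgt0Pr => e e0.
have eK0 : 0 < e / K by rewrite divr_gt0.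
have NeK : 0 <= N + e / K by rewrite addr_ge0// ltW.
have ltN : (N%:E < (N + e / K)%:E)%E by rewrite lte_fin ltrDl.
have [m oscM] := frac_maximal_oscillation _ _ _ _ _ halpha0 halphan l0 NeK mf
  (oscN _ ltN) f0.
rewrite -EFinD.
have -> : K * N + e = K * (N + e / K) by rewrite mulrDr mulrCA divff ?gt_eqF// mulr1.
apply: BLO_norm_le_oscillation oscM => //.
exact: mulr_ge0 (ltW KL0) NeK.
Qed.
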